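(* Let $\alpha>0$ be real, let $M\ge2$, and let $F$ be an $M\times N$ equiangular tight frame with $\frac{N-1}{M(M-1)}\geq\alpha$. Then for every $C\ge1$ and every $p\in[0,1]$ with $(1-p)N$ an integer and $$p\leq\frac{\alpha(C^2-1)^2}{\alpha(C^2-1)^2+(C^2+1)^2},$$ $F$ is a $(p,C)$-numerically erasure-robust frame.
   Context: An $M\times N$ frame is an $M\times N$ matrix whose columns $f_1,\dots,f_N$ span $\mathbb{C}^M$. An $M\times N$ equiangular tight frame is an $M\times N$ matrix $F$ with unit-norm columns $f_1,\dots,f_N\in\mathbb{C}^M$ such that $FF^*=A\,\mathrm{I}_M$ for some $A>0$ and $|\langle f_n,f_{n'}\rangle|$ is constant over all choices of $n\ne n'$. For an $M\times K$ matrix $B$, $\mathrm{Cond}(B)$ is the ratio of its greatest singular value to its smallest one, i.e. $\mathrm{Cond}(B)=\sqrt{\lambda_{\max}(BB^* )/\lambda_{\min}(BB^* )}$ where $BB^*$ is $M\times M$, with $\mathrm{Cond}(B)=\infty$ if $B$ has rank less than $M$. For $\mathcal{K}\subseteq\{1,\dots,N\}$, $F_{\mathcal{K}}$ is the submatrix of $F$ formed by the columns indexed by $\mathcal{K}$. Given $p\in[0,1]$ (with $(1-p)N$ an integer) and $C\ge1$, an $M\times N$ frame $F$ is a $(p,C)$-numerically erasure-robust frame if $\mathrm{Cond}(F_{\mathcal{K}})\le C$ for every $\mathcal{K}\subseteq\{1,\dots,N\}$ of size $(1-p)N$. *)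

(* Defs.v *)
From HB Require Import structures.
From mathcomp Require Import all_boot all_order all_algebra.
From mathcomp Require Import complex.
From mathcomp Require Import all_classical all_reals.

Set Implicit Arguments.
Unset Strict Implicit.
Unset Printing Implicit Defensive.

Import Order.TTheory GRing.Theory Num.Theory.

Local Open Scope classical_set_scope.
Local Open Scope sesquilinear_scope.
Local Open Scope complex_scope.
Local Open Scope ring_scope.

(* [M ^t*] is the conjugate transpose. [dotmx] is the library's Hermitian
   product on row vectors (linear in its first argument), hence the transposes;
   the value lies in [R[i]]. *)
Definition column_dot (R : realType) (M N : nat) (F : 'M[R[i]]_(M, N))
    (n n' : 'I_N) : R[i] :=
  dotmx (col n F)^T (col n' F)^T.

Definition column_norm (R : realType) (M N : nat) (F : 'M[R[i]]_(M, N))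
    (n : 'I_N) : R[i] :=
  sqrtC (column_dot F n n).

(* The columns of [F] span the whole space: the row space of [F^T] is full. *)
Definition is_frame (R : realType) (M N : nat) (F : 'M[R[i]]_(M, N)) : Prop :=
  row_full F^T.

Definition is_etf (R : realType) (M N : nat) (F : 'M[R[i]]_(M, N)) : Prop :=
  [/\ forall n : 'I_N, column_norm F n = 1,
      exists2 A : R, 0 < A & F *m F ^t* = (A%:C)%:M
    & exists c : R[i],
        forall n n' : 'I_N, n != n' -> `|column_dot F n n'| = c].

(* All eigenvalues of a Hermitian matrix are real, so for such a matrix this is
   its whole spectrum; it is finite, and nonempty in positive dimension, so that
   [sup] and [inf] below are the maximum and the minimum. *)
Definition real_spectrum (R : realType) (n : nat) (A : 'M[R[i]]_n) : set R :=
  [set a : R | eigenvalue A a%:C].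

Definition lambda_max (R : realType) (n : nat) (A : 'M[R[i]]_n) : R :=
  sup (real_spectrum A).

Definition lambda_min (R : realType) (n : nat) (A : 'M[R[i]]_n) : R :=
  inf (real_spectrum A).

Definition cond_num (R : realType) (M K : nat) (B : 'M[R[i]]_(M, K)) : \bar R :=
  if (\rank B < M)%N then +oo%E
  else (Num.sqrt (lambda_max (B *m B ^t*) / lambda_min (B *m B ^t*)))%:E.

Definition column_submx (R : realType) (M N : nat) (F : 'M[R[i]]_(M, N))
    (K : {set 'I_N}) : 'M[R[i]]_(M, #|K|) :=
  colsub (fun i : 'I_#|K| => enum_val i) F.

(* Meaningful for [p] in [0, 1] with [(1 - p) * N] an integer and [1 <= C]; the
   size condition on [K] is an equation in [R]. *)
Definition nerf (R : realType) (M N : nat) (p C : R) (F : 'M[R[i]]_(M, N)) :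
    Prop :=
  is_frame F /\
  forall K : {set 'I_N}, #|K|%:R = (1 - p) * N%:R :> R ->
    (cond_num (column_submx F K) <= C%:E)%E.

(* Main.v *)
Require Import Defs.
From mathcomp Require Import all_boot all_order all_algebra.
From mathcomp Require Import complex ring lra.
From mathcomp Require Import all_classical all_reals.

(** Write B for the submatrix of the k = (1 - p) N surviving columns and
    mu = k / M.  The columns being unit vectors, B B^* has trace k, so mu is the
    mean of its eigenvalues; the condition number is under control as soon as
    all eigenvalues lie within t mu of mu, where t = (C^2 - 1) / (C^2 + 1) is
    the solution of (1 + t) / (1 - t) = C^2 ([cond_num_le]).

    An eigenvalue deviates from mu by an eigenvalue of B B^* - mu I, hence by at
    most the Frobenius norm of that matrix ([norm_eigenvalue_le_mxtrace]).  This
    norm can be computed: tr((B B^* )^2) is the sum of the squared moduli of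
    the entries of the Gram matrix B^* B, and equiangularity makes it a function
    of k and of the common modulus only.  The same identity for F itself,
    combined with F F^* = A I, determines that modulus ([etf_coherence]).  The
    outcome ([mxtrace_subframe_deviation]) is

      || B B^* - mu I ||^2 = k (M - 1) (N - k) / (M (N - 1)),

    which after division by mu^2 reads M (M - 1) / (N - 1) * p / (1 - p), at
    most (p / (1 - p)) / alpha.  The hypothesis on p says that this is at most
    t^2 ([relative_deviation_le]). *)

Set Implicit Arguments.
Unset Strict Implicit.

Import Order.TTheory GRing.Theory Num.Theory.
Local Open Scope sesquilinear_scope.
Local Open Scope complex_scope.
Local Open Scope ring_scope.

(** * Eigenvalues and conditioning *)

(** The trace is the squared Frobenius norm of H; by Cauchy-Schwarz on each
    column of H, it bounds the squared norm of v H for every unit row v. *)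
Lemma norm_eigenvalue_le_mxtrace (C : numClosedFieldType) (n : nat)
    (H : 'M[C]_n) (a : C) :
  eigenvalue H a -> `|a| ^+ 2 <= \tr (H *m H^t*).
Proof.
case/eigenvalueP=> v vH v_neq0.
have norm_vH : dotmx (v *m H) (v *m H) = `|a| ^+ 2 * dotmx v v.
  by rewrite vH linearZl_LR linearZr_LR /= mulrA normCK.
have v_gt0 : 0 < dotmx v v := dotmx_is_dotmx v_neq0.
rewrite -(ler_pM2r v_gt0) -norm_vH mxtrace_mulC /mxtrace mulr_suml dotmxE mxE.
apply: ler_sum => j _.
have -> : (v *m H) 0 j = dotmx v (row j (H^t*)).
  by rewrite dotmxE !mxE; apply: eq_bigr => i _; rewrite !mxE conjCK.
have -> : ((v *m H)^t*) j 0 = (dotmx v (row j (H^t*)))^*.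
  rewrite dotmxE !mxE; congr (_^*).
  by apply: eq_bigr => i _; rewrite !mxE conjCK.
have -> : (H^t* *m H) j j = dotmx (row j (H^t*)) (row j (H^t*)).
  by rewrite dotmxE !mxE; apply: eq_bigr => i _; rewrite !mxE conjCK.
rewrite -normCK mulrC.
by have [] := CauchySchwarz (@dotmx C n) v (row j (H^t*)).
Qed.

(** The eigenvalues lie in [(1 - t) mu, (1 + t) mu], an interval with positive
    end points of ratio C^2; it does not contain 0, so B has rank M. *)
Lemma cond_num_le (R : realType) (M K : nat) (B : 'M[R[i]]_(M, K))
    (mu t C : R) :
    0 < mu -> 0 <= t -> t < 1 -> 0 <= C -> 1 + t = C ^+ 2 * (1 - t) ->
    (forall a, eigenvalue (B *m B^t*) a%:C -> `|a - mu| <= t * mu) ->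
  (cond_num B <= C%:E)%E.
Proof.
move=> mu_gt0 t_ge0 t_lt1 C_ge0 tC near.
have lo_gt0 : 0 < (1 - t) * mu by rewrite mulr_gt0 // subr_gt0.
rewrite /cond_num; case: ifPn => [ltrank|_].
  (* A row vector killed by B is an eigenvector of B B^* for 0, at distance mu
     from mu. *)
  have : ~~ row_free B by rewrite -row_leq_rank -ltnNge.
  rewrite -kermx_eq0 => /rowV0Pn[v v_ker v_neq0].
  have /near : eigenvalue (B *m B^t*) 0%:C.
    apply/eigenvalueP; exists v => //.
    by rewrite mulmxA (sub_kermxP v_ker) mul0mx scale0r.
  rewrite sub0r normrN gtr0_norm // => mu_le.
  exfalso; lra.
have bound a : real_spectrum (B *m B^t*) a ->
    (1 - t) * mu <= a /\ a <= C ^+ 2 * ((1 - t) * mu).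
  move=> /near; rewrite ler_norml => /andP[lo hi].
  by rewrite mulrA -tC; split; lra.
rewrite lee_fin -(ger0_norm C_ge0) -sqrtr_sqr.
apply: ler_wsqrtr; rewrite /lambda_max /lambda_min.
set S := real_spectrum _ in bound *.
have [->|S0] := eqVneq S set0.
  (* The supremum of the empty set is 0, which makes the quotient vanish. *)
  by rewrite sup0 mul0r exprn_ge0.
have {}S0 : (S !=set0)%classic by apply/set0P.
have lo_inf : (1 - t) * mu <= inf S.
  by apply: lb_le_inf => // a /bound[].
rewrite ler_pdivrMr ?(lt_le_trans lo_gt0) //.
apply: (@le_trans _ _ (C ^+ 2 * ((1 - t) * mu))).
  by apply: ge_sup => // a /bound[].
by rewrite ler_wpM2l // exprn_ge0.
Qed.

(** * Traces of frame operators and the Gram matrix *)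

Lemma column_dotE (R : realType) (M N : nat) (F : 'M[R[i]]_(M, N))
    (n n' : 'I_N) :
  column_dot F n n' = (F^t* *m F) n' n.
Proof.
by rewrite /column_dot dotmxE !mxE; apply: eq_bigr => k _; rewrite !mxE mulrC.
Qed.

Lemma column_dotC (R : realType) (M N : nat) (F : 'M[R[i]]_(M, N))
    (n n' : 'I_N) :
  column_dot F n' n = (column_dot F n n')^*.
Proof.
rewrite /column_dot !dotmxE !mxE rmorph_sum; apply: eq_bigr => k _.
by rewrite !mxE rmorphM /= conjCK mulrC.
Qed.

Lemma column_dot_submx (R : realType) (M N : nat) (F : 'M[R[i]]_(M, N))
    (K : {set 'I_N}) (j j' : 'I_#|K|) :
  column_dot (column_submx F K) j j' = column_dot F (enum_val j) (enum_val j').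
Proof. by rewrite !column_dotE !mxE; apply: eq_bigr => k _; rewrite !mxE. Qed.

Lemma mxtrace_frame (R : realType) (M N : nat) (F : 'M[R[i]]_(M, N)) :
  \tr (F *m F^t*) = \sum_n column_dot F n n.
Proof. by rewrite mxtrace_mulC; apply: eq_bigr => n _; rewrite column_dotE. Qed.

(** F F^* and the Gram matrix F^* F have squares of equal trace, and for the
    Hermitian matrix F^* F the trace of the square is the sum of the squared
    moduli of its entries. *)
Lemma mxtrace_frame_sqr (R : realType) (M N : nat) (F : 'M[R[i]]_(M, N)) :
  \tr ((F *m F^t*) *m (F *m F^t*)) = \sum_n \sum_n' `|column_dot F n n'| ^+ 2.
Proof.
rewrite -mulmxA mxtrace_mulC !mulmxA -(mulmxA (_ *m _)) /mxtrace.
apply: eq_bigr => n _; rewrite mxE; apply: eq_bigr => n' _.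
by rewrite -!column_dotE normCKC -column_dotC.
Qed.

Lemma mxtrace_equiangular (R : realType) (M N : nat) (F : 'M[R[i]]_(M, N))
    (s : R[i]) :
    (forall n, column_dot F n n = 1) ->
    (forall n n', n != n' -> `|column_dot F n n'| ^+ 2 = s) ->
  \tr (F *m F^t*) = N%:R /\
  \tr ((F *m F^t*) *m (F *m F^t*)) = N%:R * (1 + (N%:R - 1) * s).
Proof.
move=> unit_F equi_F; rewrite mxtrace_frame mxtrace_frame_sqr; split.
  by rewrite (eq_bigr (fun=> 1)) // sumr_const card_ord.
have row_sum n : \sum_n' `|column_dot F n n'| ^+ 2 = 1 + (N%:R - 1) * s.
  rewrite (bigD1 n) //= unit_F normr1 expr1n; congr (_ + _).
  rewrite (eq_bigr (fun=> s)) => [|n' n'n]; last by rewrite equi_F // eq_sym.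
  rewrite sumr_const cardC1 card_ord -subn1 -[s *+ _]mulr_natl natrB //.
  by case: (N) n => [[]|].
by rewrite (eq_bigr _ (fun n _ => row_sum n)) sumr_const card_ord mulr_natl.
Qed.

(** * Equiangular tight frames *)

(** The case of equality in the Welch bound, s = (N - M) / (M (N - 1)), in a form
    without division.  It comes from evaluating the traces of A I and A^2 I
    through the Gram matrix, then eliminating A. *)
Lemma etf_coherence (R : realType) (M N : nat) (F : 'M[R[i]]_(M, N))
    (A s : R[i]) :
    (0 < N)%N -> F *m F^t* = A%:M ->
    (forall n, column_dot F n n = 1) ->
    (forall n n', n != n' -> `|column_dot F n n'| ^+ 2 = s) ->
  M%:R * (1 + (N%:R - 1) * s) = N%:R.
Proof.
move=> N_gt0 tight unit_F equi_F.
have [] := mxtrace_equiangular unit_F equi_F.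
rewrite tight -scalar_mxM !mxtrace_scalar => trA trA2.
have N_neq0 : N%:R != 0 :> R[i] by rewrite pnatr_eq0 -lt0n.
apply: (mulfI N_neq0).
by rewrite mulrCA -trA2 -trA -[A * A *+ M]mulr_natl -[A *+ M]mulr_natl; ring.
Qed.

(** Expansion of the square; B B^* - m I is its own adjoint because m is real. *)
Lemma mxtrace_deviation (R : realType) (M K : nat) (B : 'M[R[i]]_(M, K))
    (m : R) :
  \tr ((B *m B^t* - m%:C%:M) *m (B *m B^t* - m%:C%:M)^t*)
    = \tr ((B *m B^t*) *m (B *m B^t*)) - 2 * m%:C * \tr (B *m B^t*)
      + M%:R * m%:C ^+ 2.
Proof.
set G := B *m _.
have -> : (G - m%:C%:M)^t* = G - m%:C%:M.
  have conj_m : Num.conj m%:C = m%:C by exact: conjc_real.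
  rewrite linearB /= tr_scalar_mx map_mxB map_scalar_mx /= conj_m; congr (_ - _).
  rewrite /G trmx_mul map_mxM map_trmx trmxK -map_mx_comp.
  by rewrite (eq_map_mx _ (@conjCK _)) map_mx_id.
rewrite mulmxBl !mulmxBr mul_mx_scalar mul_scalar_mx -scalar_mxM.
rewrite !raddfB /= !mxtraceZ.
by rewrite mxtrace_scalar -[_ *+ M]mulr_natl; ring.
Qed.

(** The scalar subtracted is the mean eigenvalue when the columns of F have norm
    one. *)
Definition subframe_deviation (R : realType) (M N : nat) (F : 'M[R[i]]_(M, N))
    (K : {set 'I_N}) : 'M[R[i]]_M :=
  column_submx F K *m (column_submx F K)^t* - (#|K|%:R / M%:R)%:C%:M.

(** The columns selected by K are again unit and equiangular, with the modulus
    that tightness of the whole frame imposes. *)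
Lemma mxtrace_subframe_deviation (R : realType) (M N : nat) (F : 'M[R[i]]_(M, N))
    (K : {set 'I_N}) :
    (0 < M)%N -> (1 < N)%N -> is_etf F ->
  \tr (subframe_deviation F K *m (subframe_deviation F K)^t*)
    = (#|K|%:R * (M%:R - 1) * (N%:R - #|K|%:R) / (M%:R * (N%:R - 1)))%:C.
Proof.
move=> M_gt0 N_gt1 [norm_F [A _ tight] [c equi_F]].
have unit_F n : column_dot F n n = 1.
  by rewrite -[LHS]sqrtCK -[sqrtC _]/(column_norm F n) norm_F expr1n.
have equi2_F n n' : n != n' -> `|column_dot F n n'| ^+ 2 = c ^+ 2.
  by move=> /equi_F ->.
have N_gt0 := ltnW N_gt1.
have welch := etf_coherence N_gt0 tight unit_F equi2_F.
have [] := mxtrace_equiangular (F := column_submx F K) (s := c ^+ 2).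
- by move=> j; rewrite column_dot_submx unit_F.
- by move=> j j' jj'; rewrite column_dot_submx equi2_F // (inj_eq enum_val_inj).
rewrite /subframe_deviation mxtrace_deviation => -> ->.
have M_neq0 : M%:R != 0 :> R[i] by rewrite pnatr_eq0 -lt0n.
have N1_neq0 : N%:R - 1 != 0 :> R[i]
  by rewrite -(natrB _ N_gt0) pnatr_eq0 subn_eq0 -ltnNge.
have -> : c ^+ 2 = (N%:R - M%:R) / (M%:R * (N%:R - 1)).
  apply: (mulfI (mulf_neq0 M_neq0 N1_neq0)).
  rewrite [RHS]mulrCA divff ?mulf_neq0 // -[in RHS]welch; ring.
rewrite !(rmorphM, rmorphB, fmorphV, rmorph_nat, rmorph1) /=.
by field; rewrite N1_neq0.
Qed.

Lemma etf_subframe_eigenvalue (R : realType) (M N : nat) (F : 'M[R[i]]_(M, N))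
    (K : {set 'I_N}) (a : R) :
    (0 < M)%N -> (1 < N)%N -> is_etf F ->
    eigenvalue (column_submx F K *m (column_submx F K)^t*) a%:C ->
  (a - #|K|%:R / M%:R) ^+ 2
    <= #|K|%:R * (M%:R - 1) * (N%:R - #|K|%:R) / (M%:R * (N%:R - 1)).
Proof.
move=> M_gt0 N_gt1 etf_F /eigenvalueP[v vG v_neq0].
rewrite -lecR -(@mxtrace_subframe_deviation _ _ _ F) //.
have -> : ((a - #|K|%:R / M%:R) ^+ 2)%:C = `|(a - #|K|%:R / M%:R)%:C| ^+ 2.
  by rewrite normCK [_^*]conjc_real -rmorphM.
apply: norm_eigenvalue_le_mxtrace; apply/eigenvalueP; exists v => //.
by rewrite mulmxBr vG mul_mx_scalar -scalerBl rmorphB.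
Qed.

Lemma is_etf_is_frame (R : realType) (M N : nat) (F : 'M[R[i]]_(M, N)) :
  is_etf F -> is_frame F.
Proof.
case=> _ [A A_gt0 tight] _.
rewrite /is_frame /row_full mxrank_tr eqn_leq rank_leq_row /=.
apply: leq_trans (mxrankM_maxl F (F^t*)).
rewrite tight -scalemx1 mxrank_scale_nz ?mxrank1 //.
by rewrite eq_complex /= negb_and gt_eqF.
Qed.

(** * The admissible erasure rate *)

(** With k = (1 - p) n one has n - k = p n, and the difference of the two sides
    is a nonnegative multiple of (n - 1) t^2 (1 - p) - m (m - 1) p.  This factor
    is nonnegative because both terms compare to alpha m (m - 1) t^2 (1 - p). *)
Lemma relative_deviation_le (R : realFieldType) (alpha m n p t : R) :
    1 < m -> 1 < n -> 0 <= p -> p < 1 ->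
    alpha * (m * (m - 1)) <= n - 1 -> p <= alpha * t ^+ 2 * (1 - p) ->
  ((1 - p) * n) * (m - 1) * (n - (1 - p) * n) / (m * (n - 1))
    <= (t * ((1 - p) * n / m)) ^+ 2.
Proof.
move=> m_gt1 n_gt1 p_ge0 p_lt1 alpha_le p_le.
have mm_ge0 : 0 <= m * (m - 1) by rewrite mulr_ge0; lra.
have tp_ge0 : 0 <= t ^+ 2 * (1 - p) by rewrite mulr_ge0 ?sqr_ge0; lra.
have key : 0 <= (n - 1) * (t ^+ 2 * (1 - p)) - m * (m - 1) * p.
  rewrite subr_ge0; apply: le_trans (ler_wpM2l mm_ge0 p_le) _.
  apply: le_trans (ler_wpM2r tp_ge0 alpha_le).
  by rewrite le_eqVlt; apply/orP; left; apply/eqP; ring.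
rewrite -subr_ge0.
have -> : (t * ((1 - p) * n / m)) ^+ 2
      - ((1 - p) * n) * (m - 1) * (n - (1 - p) * n) / (m * (n - 1))
    = (1 - p) * n ^+ 2 / (m ^+ 2 * (n - 1))
      * ((n - 1) * (t ^+ 2 * (1 - p)) - m * (m - 1) * p).
  by field; lra.
by rewrite mulr_ge0 // divr_ge0 // mulr_ge0 ?sqr_ge0; lra.
Qed.

Unset Implicit Arguments.

Theorem theorem5 (R : realType) (alpha : R) (M N : nat) (F : 'M[R[i]]_(M, N))
    (alpha_gt0 : 0 < alpha) (M_ge2 : (2 <= M)%N) (F_etf : is_etf F)
    (alpha_le : alpha <= (N%:R - 1) / (M%:R * (M%:R - 1)))
    (C p : R) (C_ge1 : 1 <= C) (p_ge0 : 0 <= p) (p_le1 : p <= 1)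
    (pN_int : (1 - p) * N%:R \is a Num.int)
    (p_le : p <= (alpha * (C ^+ 2 - 1) ^+ 2)
                 / (alpha * (C ^+ 2 - 1) ^+ 2 + (C ^+ 2 + 1) ^+ 2)) :
  nerf p C F.
Proof.
split=> [|K cardK]; first exact: is_etf_is_frame.
have M1 : 1 < M%:R :> R by rewrite ltr1n.
have MM : 0 < M%:R * (M%:R - 1) :> R by rewrite mulr_gt0; lra.
rewrite ler_pdivlMr // in alpha_le.
have N1 : 1 < N%:R :> R by have := mulr_gt0 alpha_gt0 MM; lra.
have C2 : 1 <= C ^+ 2 by rewrite exprn_ege1.
set t := (C ^+ 2 - 1) / (C ^+ 2 + 1).
have t_ge0 : 0 <= t by apply: divr_ge0; lra.
have t_lt1 : t < 1 by rewrite /t ltr_pdivrMr; lra.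
(* The hypothesis on p amounts to p / (1 - p) <= alpha t^2. *)
have p_t : p <= alpha * t ^+ 2 * (1 - p).
  rewrite ler_pdivlMr in p_le; last first.
    rewrite ltr_wpDl ?exprn_gt0 //; last lra.
    by rewrite mulr_ge0 ?sqr_ge0 // ltW.
  have C2p : 0 < (C ^+ 2 + 1) ^+ 2 by rewrite exprn_gt0; lra.
  rewrite /t expr_div_n mulrA mulrAC ler_pdivlMr //; lra.
(* At p = 1 the bound just obtained would say 1 <= 0. *)
have p_lt1 : p < 1.
  rewrite lt_neqAle p_le1 andbT; apply/eqP => p1; move: p_t; rewrite p1; lra.
have mu_gt0 : 0 < #|K|%:R / M%:R :> R.
  by rewrite cardK divr_gt0 ?mulr_gt0 //; lra.
apply: (cond_num_le (t := t) mu_gt0) => //.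
- lra.
- by rewrite /t; field; lra.
move=> a a_eig.
have tmu_ge0 : 0 <= t * (#|K|%:R / M%:R) by rewrite mulr_ge0 // ltW.
rewrite -ler_sqr ?nnegrE ?normr_ge0 // real_normK ?num_real //.
apply: le_trans (etf_subframe_eigenvalue _ _ _ a_eig) _ => //.
- by rewrite ltnW.
- by rewrite -(ltr1n R).
by rewrite cardK; apply: relative_deviation_le alpha_le p_t.
Qed.
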